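(* Let $p$ be a real number with $2>p\ge 1$ and let $r$ be the order of a real symmetric conference matrix. If $k$ is the order of a real symmetric Hadamard matrix, then there is an $r$-partite graph $G$ of order $n=rk$ such that $$\|G\|_p\ge\frac12 n^{1/2+1/p}\sqrt{1-1/r}-(1-1/r)n.$$
   Context: Graphs are finite, simple and undirected. A graph is $r$-partite if its vertices can be partitioned into $r$ edgeless sets. For a graph $G$ of order $n$ whose adjacency matrix has singular values $\sigma_1\ge\cdots\ge\sigma_n$, the Schatten $p$-norm of $G$ is $\|G\|_p:=(\sigma_1^p+\cdots+\sigma_n^p)^{1/p}$. An Hadamard matrix of order $k$ is a $k\times k$ matrix $H$ with entries of modulus $1$ such that $HH^*=kI_k$. A conference matrix of order $r$ is an $r\times r$ matrix $C$ with zero diagonal and off-diagonal entries of modulus $1$ such that $CC^*=(r-1)I_r$. *)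

(* Defs.v *)
From HB Require Import structures.
From mathcomp Require Import all_boot all_order all_algebra.
From mathcomp Require Import sesquilinear spectral complex.
From mathcomp Require Import reals exp.

Set Implicit Arguments.
Unset Strict Implicit.
Unset Printing Implicit Defensive.

Import Order.TTheory GRing.Theory Num.Theory.
Local Open Scope ring_scope.
Local Open Scope sesquilinear_scope.

Record sgraph (n : nat) := SGraph {
  adj :> rel 'I_n;
  adj_sym : symmetric adj;
  adj_irr : irreflexive adj }.

(* The parts are allowed to be empty. *)
Definition partite (r n : nat) (G : sgraph n) : Prop :=
  exists V : 'I_r -> {set 'I_n},
    [/\ \bigcup_i V i = [set: 'I_n],
        forall i j, i != j -> [disjoint V i & V j] &
        forall i x y, x \in V i -> y \in V i -> ~~ adj G x y].

Definition adjmx (R : nzRingType) (n : nat) (G : sgraph n) : 'M[R]_n :=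
  \matrix_(x, y) (adj G x y)%:R.

(* Since M^* M is Hermitian, hence normal, [spectral_diag] lists its eigenvalues
   with multiplicity; they are nonnegative reals. *)
Definition singular_values (R : rcfType) (m n : nat) (M : 'M[R[i]]_(m, n)) :
    seq R :=
  sort >=%R
    [seq Num.sqrt (complex.Re (spectral_diag (M^t* *m M) 0 j)) | j <- enum 'I_n].

Definition schatten_norm (R : realType) (p : R) (n : nat) (G : sgraph n) : R :=
  (\sum_(s <- singular_values (adjmx R[i] G)) s `^ p) `^ p^-1.

Definition hadamard_matrix (C : numClosedFieldType) (k : nat) (H : 'M[C]_k) :
    Prop :=
  (forall i j, `|H i j| = 1) /\ H *m H^t* = k%:R%:M.

(* The scalar is the ring difference [r%:R - 1]. *)
Definition conference_matrix (C : numClosedFieldType) (r : nat) (M : 'M[C]_r) :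
    Prop :=
  [/\ forall i, M i i = 0,
      forall i j, i != j -> `|M i j| = 1 &
      M *m M^t* = (r%:R - 1)%:M].

Definition real_symmetric (C : numClosedFieldType) (n : nat) (M : 'M[C]_n) :
    Prop :=
  M \is a realmx /\ M^T = M.

(* Main.v *)
Require Import Defs.
From mathcomp Require Import all_boot all_order all_algebra.
From mathcomp Require Import complex reals exp.
From mathcomp Require Import sesquilinear spectral mxtens.
From mathcomp Require Import ring lra.

(** Let [M] be the conference matrix, [H] the Hadamard matrix and [K = M *t H]
their Kronecker product. The entries of [K] are 0, 1 and -1, its diagonal
blocks vanish, it is symmetric, and [K K^* = c^2 I] with [c^2 = (r - 1) k], so
all its singular values equal [c]. Replacing [K] by [- K] if necessary, its
entries have a nonnegative sum. Join two vertices when the corresponding entry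
of [K] is 1: this gives a graph [G] which is [r]-partite, the blocks of indices
being its parts.

Testing the adjacency matrix [A] of [G] against [K] bounds the singular values
[s_j] of [A] from below in the case [p = 1]. On the one hand
[2 tr (K A) = tr (K K^* ) + sum K >= n c^2] ([trace_sign_graph]). On the other
hand [|tr (K A)| <= c sum_j s_j], because the rows of [K] are orthogonal of norm [c]
([norm_trace_mulmx_le]: the duality between the trace norm and the operator
norm). Hence the mean of the [s_j] is at least [c / 2], and by convexity of the
[p]-th power the same holds for their power mean of exponent [p]
([schatten_norm_ge]), that is,
[||G||_p >= n^(1/p) c / 2 = n^(1/2 + 1/p) sqrt (1 - 1/r) / 2].

The choice of the sign of [K] is what improves on the triangle inequality: in
[2 A = K + B], with [B] the adjacency matrix of the complete [r]-partite graph,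
it makes the contribution of [B] to the trace nonnegative, whereas bounding the
norm of [B] would cost up to [(1 - 1/r) n]. The stated bound then follows since
[(1 - 1/r) n >= 0]. *)

Import Order.TTheory GRing.Theory Num.Theory.
Local Open Scope ring_scope.
Local Open Scope sesquilinear_scope.
Local Open Scope complex_scope.

(** * Power means *)

(** Bernoulli's inequality for real exponents: it is Young's inequality for the
product of [x] and 1, with conjugate exponents [p] and [p / (p - 1)]. *)
Lemma bernoulli_powR (R : realType) (p x : R) :
  1 <= p -> 0 <= x -> 1 + p * (x - 1) <= x `^ p.
Proof.
move=> p1 x0; have p0 : 0 < p by apply: lt_le_trans p1.
have [->|pN1] := eqVneq p 1; first by rewrite powRr1 //; lra.
have p1' : 0 < p - 1 by rewrite subr_gt0 lt_neqAle eq_sym pN1.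
have q0 : 0 < p / (p - 1) by rewrite divr_gt0.
have := @conjugate_powR R x 1 p (p / (p - 1)) x0 ler01 p0 q0.
rewrite mulr1 powR1 mul1r invf_div => /(_ _)/wrap[]; first by field; lra.
rewrite -(ler_pM2l p0); have -> : p * (x `^ p / p + (p - 1) / p) = x `^ p + (p - 1).
  by field; lra.
by move=> ?; lra.
Qed.

(** Summing over [s] the inequality that puts the convex function [x `^ p] above
its tangent at [t], which [bernoulli_powR] yields at [x / t]. *)
Lemma sum_powR_ge (R : realType) (s : seq R) (p t : R) :
  1 <= p -> 0 <= t -> (forall x, x \in s -> 0 <= x) ->
  (size s)%:R * t <= \sum_(x <- s) x ->
  (size s)%:R * t `^ p <= \sum_(x <- s) x `^ p.
Proof.
move=> p1 t0 s0 le_ts; have p0 : 0 < p by apply: lt_le_trans p1.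
have [->|tN0] := eqVneq t 0.
  by rewrite powR0 ?gt_eqF // mulr0; apply: sumr_ge0 => i _; apply: powR_ge0.
have {t0 tN0}t_gt0 : 0 < t by rewrite lt0r tN0.
have tangent x : x \in s -> t `^ p * (1 - p) + t `^ p * p / t * x <= x `^ p.
  move=> /s0 x0; have -> : x `^ p = t `^ p * (x / t) `^ p.
    rewrite -powRM ?divr_ge0 ?(ltW t_gt0) //.
    by congr (_ `^ _); field; lra.
  have -> : t `^ p * (1 - p) + t `^ p * p / t * x =
            t `^ p * (1 + p * (x / t - 1)) by field; lra.
  rewrite ler_wpM2l ?powR_ge0 //; apply: bernoulli_powR => //.
  by rewrite divr_ge0 ?(ltW t_gt0).
rewrite [X in _ <= X]big_seq.
apply: le_trans (ler_sum _ tangent); rewrite -big_seq big_split /=.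
rewrite -[X in _ <= _ + X]mulr_sumr big_const_seq count_predT.
rewrite iter_addr_0 -[X in _ <= X + _]mulr_natl.
have slope_ge0 : 0 <= t `^ p * p / t.
  by rewrite divr_ge0 ?mulr_ge0 ?powR_ge0 ?(ltW p0) ?(ltW t_gt0).
rewrite -lerBlDl; apply: le_trans (ler_wpM2l slope_ge0 le_ts).
by rewrite le_eqVlt; apply/orP; left; apply/eqP; field; lra.
Qed.

(** * Singular values and traces *)

Lemma sum_singular_values (R : rcfType) (m n : nat) (M : 'M[R[i]]_(m, n)) :
  \sum_(s <- singular_values M) s =
  \sum_j Num.sqrt (complex.Re (spectral_diag (M^t* *m M) 0 j)).
Proof. by rewrite (perm_big _ (permEl (perm_sort _ _))) big_map big_enum. Qed.

Lemma size_singular_values (R : rcfType) (m n : nat) (M : 'M[R[i]]_(m, n)) :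
  size (singular_values M) = n.
Proof. by rewrite size_sort size_map size_enum_ord. Qed.

Lemma singular_values_ge0 {R : rcfType} {m n : nat} {M : 'M[R[i]]_(m, n)} {s : R} :
  s \in singular_values M -> 0 <= s.
Proof. by rewrite mem_sort => /mapP[j _ ->]; apply: sqrtr_ge0. Qed.

Lemma trmxC_mul (C : numClosedFieldType) (m n q : nat) (A : 'M[C]_(m, n))
    (B : 'M[C]_(n, q)) :
  (A *m B)^t* = B^t* *m A^t*.
Proof. by rewrite trmx_mul map_mxM. Qed.

Lemma dotmx_row (C : numClosedFieldType) (m q n : nat) (A : 'M[C]_(m, n))
    (B : 'M[C]_(q, n)) i j :
  dotmx (row i A) (row j B) = (A *m B^t*) i j.
Proof. by rewrite dotmxE !mxE; apply: eq_bigr => l _; rewrite !mxE. Qed.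

(** If [P] diagonalizes [M^* M], the columns of [M P^*] have the singular values
of [M] as their norms. They appear here conjugated, as the rows of [P M^*]. *)
Lemma gram_spectral_diagE (R : rcfType) (m n : nat) (M : 'M[R[i]]_(m, n)) j :
  let v := row j (spectralmx (M^t* *m M) *m M^t*) in
  dotmx v v = (Num.sqrt (complex.Re (spectral_diag (M^t* *m M) 0 j)) ^+ 2)%:C.
Proof.
set S := M^t* *m M; set P := spectralmx S; move=> v.
have Pu : P \is unitarymx := spectral_unitarymx S.
have Sn : S \is normalmx by apply/normalmxP; rewrite /S trmxC_mul trmxCK.
have SE : P *m S *m P^t* = diag_mx (spectral_diag S).
  rewrite {1}(orthomx_spectralP Sn) invmx_unitary // !mulmxA (unitarymxP Pu).
  by rewrite mul1mx mulmxtVK.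
have vE : dotmx v v = spectral_diag S 0 j.
  rewrite dotmx_row trmxC_mul trmxCK mulmxA -[_ *m M^t* *m M]mulmxA SE.
  by rewrite mxE eqxx mulr1n.
(* Being a squared norm, the eigenvalue is a nonnegative real. *)
have v_ge0 : 0 <= dotmx v v by apply: dnorm_ge0.
move: (v_ge0); rewrite vE lecE => /andP[/eqP /= im0 re0].
by rewrite sqr_sqrtr //; apply/eqP; rewrite eq_complex /= im0 !eqxx.
Qed.

(** With [P] diagonalizing [M^* M], the trace of [K M] is that of [(P K) (M P^* )].
The rows of [P K] all have norm [c] and the columns of [M P^*] have the singular
values as norms, so Cauchy-Schwarz bounds each diagonal entry. *)
Lemma norm_trace_mulmx_le {R : rcfType} {m n : nat} (K : 'M[R[i]]_(n, m))
    (M : 'M[R[i]]_(m, n)) (c : R) :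
  0 <= c -> K *m K^t* = ((c ^+ 2)%:C)%:M ->
  `|\tr (K *m M)| <= (c * \sum_(s <- singular_values M) s)%:C.
Proof.
move=> c0 KK; set P := spectralmx (M^t* *m M).
have Pu : P \is unitarymx := spectral_unitarymx _.
pose u j := row j (P *m K); pose v j := row j (P *m M^t*).
have -> : \tr (K *m M) = \sum_j dotmx (u j) (v j).
  have -> : \tr (K *m M) = \tr (P *m (K *m M) *m P^t*).
    by rewrite [RHS]mxtrace_mulC -(invmx_unitary Pu) mulKmx // unitarymx_unit.
  by apply: eq_bigr => j _; rewrite dotmx_row trmxC_mul trmxCK !mulmxA.
rewrite sum_singular_values mulr_sumr rmorph_sum.
apply: le_trans (ler_norm_sum _ _ _) _; apply: ler_sum => j _.
have cs_ge0 : 0 <= (c * Num.sqrt (complex.Re (spectral_diag (M^t* *m M) 0 j)))%:C.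
  by rewrite lecR mulr_ge0 // sqrtr_ge0.
rewrite -(@ler_pXn2r _ 2) ?nnegrE //.
have CS : `|dotmx (u j) (v j)| ^+ 2 <= dotmx (u j) (u j) * dotmx (v j) (v j).
  by rewrite CauchySchwarz.
apply: le_trans CS _.
rewrite [dotmx (v j) _]gram_spectral_diagE dotmx_row trmxC_mul !mulmxA.
rewrite -[P *m K *m K^t*]mulmxA KK.
rewrite mul_mx_scalar -scalemxAl (unitarymxP Pu) !mxE eqxx mulr1.
by rewrite -!rmorphM -rmorphXn exprMn.
Qed.

(** Reduction of all exponents [p >= 1] to the trace norm. *)
Lemma schatten_norm_ge (R : realType) (p t : R) (n : nat) (G : sgraph n) :
  1 <= p -> 0 <= t ->
  n%:R * t <= \sum_(s <- singular_values (adjmx R[i] G)) s ->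
  n%:R `^ p^-1 * t <= schatten_norm p G.
Proof.
move=> p1 t0 le_t; have p0 : 0 < p by apply: lt_le_trans p1.
have := @sum_powR_ge R (singular_values (adjmx R[i] G)) p t p1 t0.
rewrite size_singular_values => /(_ (@singular_values_ge0 _ _ _ _) le_t) le_tp.
have -> : t = (t `^ p) `^ p^-1 by rewrite -powRrM mulfV ?gt_eqF // powRr1.
rewrite -powRM ?powR_ge0 ?ler0n //.
apply: ge0_ler_powR => //; rewrite ?nnegrE ?invr_ge0 ?(ltW p0) //.
- by rewrite mulr_ge0 ?ler0n ?powR_ge0.
- by apply: sumr_ge0 => s _; apply: powR_ge0.
Qed.

(** * The graph of a sign matrix *)

Definition signmx {C : numClosedFieldType} {m n : nat} (K : 'M[C]_(m, n)) : Prop :=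
  forall x y, [\/ K x y = 0, K x y = 1 | K x y = -1].

Lemma signmxN (C : numClosedFieldType) (m n : nat) (K : 'M[C]_(m, n)) :
  signmx K -> signmx (- K).
Proof.
by move=> sK x y; rewrite mxE; case: (sK x y) => ->; rewrite ?oppr0 ?opprK;
  [apply: Or31 | apply: Or33 | apply: Or32].
Qed.

(** Entrywise, [2 a [a = 1] = |a|^2 + a] whenever [a] is 0, 1 or -1. *)
Lemma trace_sign_graph {C : numClosedFieldType} {n : nat} (K : 'M[C]_n)
    (G : sgraph n) :
  signmx K -> (forall x y, adj G x y = (K y x == 1)) ->
  \tr (K *m adjmx C G) = 2^-1 * (\tr (K *m K^t*) + \sum_x \sum_y K x y).
Proof.
move=> sK adjE; rewrite -big_split mulr_sumr; apply: eq_bigr => x _ /=.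
rewrite !mxE -big_split mulr_sumr; apply: eq_bigr => y _ /=.
rewrite !mxE adjE; case: (sK x y) => ->.
- by rewrite !mul0r addr0 mulr0.
- by rewrite eqxx conjC1 !mul1r /=; field.
- by rewrite -normCK normrN1 expr1n subrr mulr0 eqNr oner_eq0 mulr0.
Qed.

(** One of the graphs of the positive entries of [K] and of its negative entries
will do: it is the one for which the entries have a nonnegative sum, which may
then be dropped in [trace_sign_graph]. *)
Lemma sign_graph {R : realType} (p c : R) {n : nat} (K : 'M[R[i]]_n) :
  1 <= p -> 0 <= c -> signmx K -> K^T = K -> (forall x, K x x = 0) ->
  K *m K^t* = ((c ^+ 2)%:C)%:M ->
  exists G : sgraph n, (forall x y, adj G x y -> K x y != 0) /\
    n%:R `^ p^-1 * (c / 2) <= schatten_norm p G.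
Proof.
move=> p1 c0 sK symK diagK KK.
wlog sumK_ge0 : K sK symK diagK KK / 0 <= \sum_x \sum_y K x y => [posK|].
  have : \sum_x \sum_y K x y \is Num.real.
    apply: rpred_sum => x _; apply: rpred_sum => y _.
    by case: (sK x y) => ->; rewrite ?rpredN ?rpred0 ?rpred1.
  move=> /real_ge0P[|/ltW neg]; first exact: posK.
  have [|||||G [adjG normG]] := posK (- K).
  - exact: signmxN.
  - by rewrite linearN /= symK.
  - by move=> x; rewrite mxE diagK oppr0.
  - by rewrite linearN /= map_mxN mulmxN mulNmx opprK.
  - under eq_bigr do under eq_bigr do rewrite mxE.
    under eq_bigr do rewrite sumrN.
    by rewrite sumrN oppr_ge0.
  by exists G; split=> // x y /adjG; rewrite mxE oppr_eq0.
have Ksym x y : K y x = K x y by rewrite -[in LHS]symK mxE.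
have adj_sym : symmetric (fun x y => K y x == 1) by move=> x y; rewrite Ksym.
have adj_irr : irreflexive (fun x y => K y x == 1).
  by move=> x; rewrite diagK eq_sym oner_eq0.
pose G := SGraph adj_sym adj_irr; exists G; split=> [x y /= /eqP|].
  by rewrite Ksym => ->; rewrite oner_eq0.
apply: schatten_norm_ge => //; first by rewrite divr_ge0.
(* The factor [c] of the trace bound can be cancelled only if it is nonzero;
   [K] vanishes otherwise. *)
have [->|cN0] := eqVneq c 0.
  rewrite mul0r mulr0 big_seq; apply: sumr_ge0 => s; exact: singular_values_ge0.
have c_gt0 : 0 < c by rewrite lt0r cN0.
rewrite -(ler_pM2l c_gt0) -lecR.
apply: le_trans (norm_trace_mulmx_le K _ _ c0 KK).
have trE := trace_sign_graph K G sK (fun _ _ => erefl).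
have tr_ge : (c * (n%:R * (c / 2)))%:C <= \tr (K *m adjmx R[i] G).
  rewrite trE KK mxtrace_scalar.
  have -> : (c * (n%:R * (c / 2)))%:C = 2^-1 * ((c ^+ 2)%:C *+ n).
    rewrite -[(c ^+ 2)%:C *+ n]mulr_natl -!(rmorph_nat (real_complex R)).
    rewrite -fmorphV -!rmorphM.
    by congr (_%:C); field.
  by rewrite ler_wpM2l ?invr_ge0 ?ler0n // lerDl.
rewrite ger0_norm //; apply: le_trans tr_ge.
by rewrite lecR !mulr_ge0 ?invr_ge0 ?ler0n.
Qed.

(** * The Kronecker product of a conference and a Hadamard matrix *)

Lemma tens_scalar_scalar (C : comPzRingType) (r k : nat) (a b : C) :
  (a%:M : 'M_r) *t (b%:M : 'M_k) = (a * b)%:M.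
Proof.
apply/matrixP => x y.
case: (mxtens_indexP x) => x1 x2; case: (mxtens_indexP y) => y1 y2.
rewrite tensmxE !mxE (can_eq (@mxtens_indexK r k)) xpair_eqE.
by do 2!case: eqP => _; rewrite /= ?mulr1n ?mulr0n ?mulr0 ?mul0r.
Qed.

Lemma real_norm1_sign {C : numDomainType} {x : C} :
  x \is Num.real -> `|x| = 1 -> x = 1 \/ x = -1.
Proof.
by move=> xR /eqP; rewrite real_eqr_norml // ler01 andbT => /orP[] /eqP ->;
  [left | right].
Qed.

Theorem theorem4p47 (R : realType) (p : R) (r k n : nat)
    (p_ge1 : 1 <= p) (p_lt2 : p < 2)
    (r_gt0 : (0 < r)%N) (k_gt0 : (0 < k)%N)
    (conf : exists M : 'M[R[i]]_r, conference_matrix M /\ real_symmetric M)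
    (had : exists H : 'M[R[i]]_k, hadamard_matrix H /\ real_symmetric H)
    (n_eq : n = (r * k)%N) :
  exists G : sgraph n,
    partite r G /\
    schatten_norm p G >=
      2^-1 * n%:R `^ (2^-1 + p^-1) * Num.sqrt (1 - r%:R^-1)
      - (1 - r%:R^-1) * n%:R.
Proof.
subst n; case: conf => M [[diagM normM MM] [realM symM]].
case: had => H [[normH HH] [realH symH]].
have r_ge1 : 1 <= r%:R :> R by rewrite ler1n.
pose K := M *t H.
have signM a b : [\/ M a b = 0, M a b = 1 | M a b = -1].
  have [->|ab] := eqVneq a b; first by rewrite diagM; apply: Or31.
  by have [->|->] := real_norm1_sign (mxOverP realM a b) (normM _ _ ab);
    [apply: Or32 | apply: Or33].
have signK : signmx K.
  move=> x y; rewrite mxE; set h := H _ _.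
  have [->|->] : h = 1 \/ h = -1
    by apply: real_norm1_sign (mxOverP realH _ _) (normH _ _).
    by rewrite mulr1.
  by rewrite mulrN1; case: (signM (mxtens_unindex x).1 (mxtens_unindex y).1) => ->;
    rewrite ?oppr0 ?opprK; [apply: Or31 | apply: Or33 | apply: Or32].
have symK : K^T = K by rewrite trmx_tens symM symH.
have blockK x y : (mxtens_unindex x).1 = (mxtens_unindex y).1 -> K x y = 0.
  by move=> xy; rewrite mxE xy diagM mul0r.
pose c := Num.sqrt ((r%:R - 1) * k%:R : R).
have c2 : c ^+ 2 = (r%:R - 1) * k%:R.
  by rewrite sqr_sqrtr // mulr_ge0 ?ler0n ?subr_ge0.
have KK : K *m K^t* = ((c ^+ 2)%:C)%:M.
  rewrite trmx_tens map_mxT tensmx_mul MM HH tens_scalar_scalar c2.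
  by congr (_%:M); rewrite rmorphM rmorphB rmorph1 !rmorph_nat.
have [G [adjG normG]] := sign_graph p c K p_ge1 (sqrtr_ge0 _) signK symK
  (fun x => blockK x x erefl) KK.
exists G; split.
  exists (fun a => [set x | (mxtens_unindex x).1 == a]); split.
  - by apply/setP=> x; rewrite inE; apply/bigcupP; exists (mxtens_unindex x).1;
      rewrite ?inE.
  - move=> a b ab; rewrite -setI_eq0; apply/eqP/setP=> x; rewrite !inE.
    by apply: contraNF ab => /andP[/eqP-> /eqP->].
  - move=> a x y; rewrite !inE => /eqP xa /eqP ya; apply/negP => /adjG.
    by rewrite blockK ?xa ?ya ?eqxx.
have r_gt0' : 0 < r%:R :> R by rewrite ltr0n.
have n_gt0 : 0 < (r * k)%:R :> R by rewrite ltr0n muln_gt0 r_gt0.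
have inv_le1 : r%:R^-1 <= 1 :> R by rewrite invf_le1.
apply: le_trans normG; rewrite lerBlDr -[X in X <= _]addr0; apply: lerD; last first.
  by rewrite mulr_ge0 ?subr_ge0 // ltW.
rewrite le_eqVlt; apply/orP; left; apply/eqP.
rewrite powRD ?(gt_eqF n_gt0) ?implybT // powR12_sqrt ?ler0n //.
have -> : c = Num.sqrt (r * k)%:R * Num.sqrt (1 - r%:R^-1).
  rewrite -sqrtrM ?ler0n // natrM; congr Num.sqrt.
  by field; rewrite gt_eqF.
by ring.
Qed.
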